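(* Let $d\ge 2$ be an integer. There exist a constant $C_d>0$ and an integer $n_0(d)$ such that for every $n\ge n_0(d)$ the following holds: if $\mathcal{F}\subseteq\binom{[n]}{d+1}$ has VC-dimension at most $d$, then $$|\mathcal{F}|\le\binom{n-1}{d}+C_d\, n^{\,d-1-\frac{1}{4d-2}}.$$
   Context: $\binom{[n]}{k}$ denotes the family of all $k$-element subsets of $[n]=\{1,\dots,n\}$. A family $\mathcal{F}$ of subsets of $[n]$ shatters a set $S\subseteq[n]$ if for every $A\subseteq S$ there is $F\in\mathcal{F}$ with $F\cap S=A$. The VC-dimension of $\mathcal{F}$ is the largest size of a set shattered by $\mathcal{F}$. *)

(* Defs.v *)
From mathcomp Require Import all_boot.
Set Implicit Arguments. Unset Strict Implicit. Unset Printing Implicit Defensive.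

Definition shatters (T : finType) (F : {set {set T}}) (S : {set T}) : Prop :=
  forall A : {set T}, A \subset S -> exists2 G, G \in F & G :&: S = A.

Definition VCdim_le (T : finType) (F : {set {set T}}) (d : nat) : Prop :=
  forall S : {set T}, shatters F S -> #|S| <= d.

Definition uniform (T : finType) (F : {set {set T}}) (k : nat) : Prop :=
  forall G, G \in F -> #|G| = k.

(* Main.v *)
Require Import Defs.
From mathcomp Require Import all_boot zify.

Set Implicit Arguments.
Unset Strict Implicit.
Unset Printing Implicit Defensive.

(** Write [deg D] for the number of members of [F] above a [d]-set [D]. Members
    of [F] having a subset [D] with [deg D = 1] can be charged to that [D]; if
    all members are of this kind, double counting the pairs [D \subset G] with
    [deg D <= n - d] gives [#|F| <= 'C(n.-1, d)]. The other ("unowned") members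
    must be paid for by the defects [n - d - deg D] of the sets with
    [deg D != 1].

    Let [G] be unowned and let [B] be a subset of [G] that is not a trace on [G].
    A branching argument shows that, up to [O(n^(d-2))] exceptions, two points
    [x], [y] of [G] outside [B] meet every member of [F] containing [B], and we
    may then enlarge [B] to [G] minus [x] and [y]. The two links [nb (x |: B)]
    and [nb (y |: B)] lie outside [B], and a common point [z] makes [z |: B] a
    set of degree 2; if there are few sets of degree 2, the defects of [x |: B]
    and [y |: B] add up to about [n] and pay for [G], and if there are many,
    their own defects pay for all unowned members.

    The same [D] may be used from two bases [v |: A] and [u |: A]. But two such
    mutual pairs over the same [A] in general position produce a set of degree 0
    above [A], whose defect [n - d] is not used otherwise. So [k] mutual pairs
    come with about [k^2] sets of degree 0, and the total loss is
    [O(n^(d-2))]. *)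

Lemma sum_setC_setD1 (T : finType) (f : {set T} -> T -> nat) :
  \sum_(B : {set T}) \sum_(v in ~: B) f B v = \sum_(D : {set T}) \sum_(v in D) f (D :\ v) v.
Proof.
rewrite (exchange_big_dep predT) //= [RHS](exchange_big_dep predT) //=.
apply: eq_bigr => v _.
rewrite (reindex_onto (fun B => B :\ v) (fun D => v |: D)) /=; last first.
  by move=> B; rewrite inE => vB; rewrite setU1K.
apply: eq_bigl => B; rewrite !inE eqxx /=.
by apply/eqP/idP => [<-|vB]; rewrite ?setU11 // setD1K.
Qed.

(** * Mutual pairs in a digraph of bounded out-degree *)

Section MutualPairs.
Variables (T : finType) (V : T -> {set T}) (Z : rel T).
Hypothesis cardV : forall v, #|V v| <= 4.

Definition mutual := [set p : T * T | (p.2 \in V p.1) && (p.1 \in V p.2)].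

Lemma sum_mutual_fst (f : T -> nat) : \sum_(p in mutual) f p.1 <= 4 * \sum_a f a.
Proof.
rewrite [X in X <= _](eq_bigl (fun p => true && (p.2 \in V p.1) && (p.1 \in V p.2))).
  rewrite big_mkcondr /=.
  apply: (@leq_trans (\sum_(p : T * T | true && (p.2 \in V p.1)) f p.1)).
    by apply: leq_sum => p _; case: ifP.
  rewrite -(pair_big_dep predT (fun a b => b \in V a) (fun a b => f a)) /=.
  rewrite big_distrr /=; apply: leq_sum => a _.
  by rewrite sum_nat_const leq_mul2r cardV orbT.
by move=> p; rewrite inE.
Qed.

Lemma sum_mutual_snd (f : T -> nat) : \sum_(p in mutual) f p.2 <= 4 * \sum_a f a.
Proof.
apply: leq_trans (sum_mutual_fst f).
have swapK : involutive (fun p : T * T => (p.2, p.1)) by case.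
rewrite (reindex_inj (inv_inj swapK)) /=.
by apply: eq_leq; apply: eq_bigl => p; rewrite !inE andbC.
Qed.

Let near (p : T * T) := V p.1 :|: V p.2.

(** Every ordered couple [(p, q)] of mutual pairs has a coordinate of one near the other or yields a
    [Z]-pair. As [near p] has at most 8 points, each a coordinate of at most 4 + 4 mutual pairs,
    closeness costs 64 per pair in each direction; a [Z]-pair is reached at most 8 * 4 times. *)
Lemma card_mutual :
  (forall p q, p \in mutual -> q \in mutual ->
     q.1 \notin near p -> q.2 \notin near p ->
     p.1 \notin near q -> p.2 \notin near q -> Z p.1 q.1 || Z p.1 q.2) ->
  #|mutual| ^ 2 <= 128 * #|mutual| + 32 * \sum_a \sum_b Z a b.
Proof.
move=> Zp.
have card_near p : \sum_a (a \in near p : nat) <= 8.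
  rewrite -big_mkcond sum1_card /near (leq_trans (leq_card_setU _ _)) //.
  by rewrite (leq_add (cardV _) (cardV _)).
pose g (p q : T * T) := (q.1 \in near p : nat) + (q.2 \in near p : nat).
pose h (p q : T * T) := (Z p.1 q.1 : nat) + (Z p.1 q.2 : nat).
have sum_g p : \sum_(q in mutual) g p q <= 64.
  rewrite big_split /=; apply: (@leq_add _ _ 32 32).
    apply: leq_trans (sum_mutual_fst (fun a => a \in near p : nat)) _.
    by rewrite (leq_mul (leqnn 4) (card_near p)).
  apply: leq_trans (sum_mutual_snd (fun a => a \in near p : nat)) _.
  by rewrite (leq_mul (leqnn 4) (card_near p)).
have sum_h p : \sum_(q in mutual) h p q <= 8 * \sum_b Z p.1 b.
  rewrite big_split /= (_ : 8 = 4 + 4) // mulnDl.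
  apply: leq_add. exact: (sum_mutual_fst (fun b => Z p.1 b : nat)).
  exact: (sum_mutual_snd (fun b => Z p.1 b : nat)).
have -> : #|mutual| ^ 2 = \sum_(p in mutual) \sum_(q in mutual) 1.
  by rewrite sum_nat_const sum1_card mulnn.
apply: (@leq_trans (\sum_(p in mutual) \sum_(q in mutual) (g p q + g q p + h p q))).
  apply: leq_sum => p Pp; apply: leq_sum => q Pq.
  have := Zp p q Pp Pq; rewrite /g /h.
  by do 4!case: (_ \in near _) => //=; do 2!case: (Z _ _) => //=; move=> /(_ isT isT isT isT).
have sum_gg : \sum_(p in mutual) \sum_(q in mutual) g p q <= 64 * #|mutual|.
  apply: leq_trans (leq_sum _ (fun p _ => sum_g p)) _.
  by rewrite sum_nat_const mulnC.
have sum_hh : \sum_(p in mutual) \sum_(q in mutual) h p q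
    <= 32 * \sum_a \sum_b Z a b.
  apply: leq_trans (leq_sum _ (fun p _ => sum_h p)) _.
  rewrite -big_distrr /= (_ : 32 = 8 * 4) // -mulnA leq_mul2l /=.
  exact: (sum_mutual_fst (fun a => \sum_b Z a b)).
move: g h {sum_g sum_h} sum_gg sum_hh => g h sum_gg sum_hh.
under eq_bigr do rewrite !big_split /=.
rewrite !big_split /= [X in _ + X + _]exchange_big /=.
by rewrite leq_add // (_ : 128 = 64 + 64) // mulnDl leq_add.
Qed.

End MutualPairs.

(** * Numerical bookkeeping and covering sums *)

Lemma leq_bin_expn n k : 'C(n, k) <= n ^ k.
Proof.
apply: (@leq_trans (n ^_ k)); first by rewrite -bin_ffact leq_pmulr ?fact_gt0.
by elim: k => // k IHk; rewrite ffactnSr expnSr leq_mul ?leq_subr.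
Qed.

(** Arithmetic of [card_uniform]: [x], [y], [g], [e] count owned, unowned, good and exceptional
    members, [c] is the binomial coefficient, [S] the total defect over degrees other than 1, [S2]
    its part from degrees at least 2, [W] the defect seen from the tips, [Q] the number of mutual
    pairs, [T0] and [T2] the numbers of sets of degree 0 and 2, and [N] is [n ^ (d - 2)]. *)
Lemma combine_bounds (n d x y g e c S W Q T0 T2 S2 N K1 K2 : nat) :
    0 < d -> 2 * (d + 2) <= n ->
    n * x + d.+1 * y + S <= n * c ->
    y <= g + e -> g <= y -> e <= N * K1 -> y <= n * N * K2 ->
    (n - d) * g <= W + 3 * g + d * T2 ->
    W <= S2 + n * Q ->
    64 * d ^ 2 * Q <= N * (64 * d ^ 2 * (128 + 64 * d ^ 2)) + 32 * (d.-1 * (d * T0)) ->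
    (n - d) * T0 + S2 <= S -> (n - d - 2) * T2 <= S2 ->
  x + y <= c + (K1 + (2 * d + 3) * K2 + 128 + 64 * d ^ 2) * N.
Proof.
move=> d0 dn count yge gy eK yK over tips mut lowS twoS.
have n0 : 0 < n by lia.
(* If [S < n * y], the degree-2 sets, of defect about [n], number only [O(y)]. *)
case: (leqP (n * y) S) => [nyS|Sny].
  suff : x + y <= c by lia.
  rewrite -(leq_pmul2l n0) mulnDr; apply: leq_trans count; lia.
have T2y : T2 <= 2 * y.
  rewrite -(leq_pmul2l n0); have : n * T2 <= 2 * (n - d - 2) * T2.
    by rewrite leq_mul2r; apply/orP; right; lia.
  lia.
(* The factor [64 * d ^ 2] leaves only half of [T0]; by [n <= 2 * (n - d)], [n] times that half is
   at most the defect [(n - d) * T0] of the sets of degree 0. *)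
have Q2 : 2 * Q <= 2 * (N * (128 + 64 * d ^ 2)) + T0.
  have d32 : 0 < 32 * d ^ 2 by rewrite muln_gt0 expn_gt0 d0.
  rewrite -(leq_pmul2l d32).
  have dd : d.-1 * (d * T0) <= d ^ 2 * T0.
    by rewrite expnS expn1 -mulnA leq_mul2r leq_pred orbT.
  move: (d ^ 2) mut dd {d32} => q; lia.
have nQ : n * Q <= n * N * (128 + 64 * d ^ 2) + (n - d) * T0.
  have nT0 : n * T0 <= 2 * (n - d) * T0.
    by rewrite leq_mul2r; apply/orP; right; lia.
  have : n * (2 * Q) <= n * (2 * (N * (128 + 64 * d ^ 2)) + T0) by rewrite leq_mul2l Q2 orbT.
  move: (d ^ 2) => q; lia.
have dT2 : d * T2 <= 2 * d * (n * N * K2).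
  have : d * T2 <= d * (2 * (n * N * K2)) by rewrite leq_mul2l; apply/orP; right; lia.
  lia.
have ne : (n - d) * y <= (n - d) * g + n * N * K1.
  have : (n - d) * y <= (n - d) * (g + e) by rewrite leq_mul2l yge orbT.
  have : (n - d) * e <= n * (N * K1) by rewrite leq_mul // leq_subr.
  lia.
rewrite -(leq_pmul2l n0).
have : n * y = (n - d) * y + d * y by rewrite -mulnDl subnK //; lia.
move: (d ^ 2) nQ => q nQ; lia.
Qed.

Lemma card_bigcup_leq (I T : finType) (A : {set I}) (f : I -> {set T}) k :
  (forall i, i \in A -> #|f i| <= k) -> #|\bigcup_(i in A) f i| <= #|A| * k.
Proof.
move=> fk; rewrite -sum_nat_const.
elim/big_rec2: _ => [|i m U Ai Um]; first by rewrite cards0.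
by rewrite (leq_trans (leq_card_setU _ _)) // leq_add ?fk.
Qed.

Lemma sum_cover (T : finType) (g : {set T} -> nat) k :
  \sum_(B : {set T} | #|B| == k) \sum_(v in ~: B) g (v |: B)
    = k.+1 * \sum_(D : {set T} | #|D| == k.+1) g D.
Proof.
rewrite big_mkcond /= (eq_bigr (fun B : {set T} =>
  \sum_(v in ~: B) (#|B| == k) * g (v |: B))); last first.
  by move=> B _; rewrite -big_distrr /=; case: eqP; rewrite ?mul1n ?mul0n.
rewrite (sum_setC_setD1 (fun B v => (#|B| == k) * g (v |: B))) /=.
rewrite [in RHS]big_mkcond big_distrr /=; apply: eq_bigr => D _.
rewrite (eq_bigr (fun=> (#|D| == k.+1) * g D)) => [|v vD].
  by rewrite sum_nat_const; case: eqP => [->|]; rewrite ?mul0n ?muln0 ?mul1n.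
by rewrite setD1K // (cardsD1 v D) vD eqSS.
Qed.

(** * Degrees, owned members and the total defect *)

Section UniformFamily.
Variables (T : finType) (F : {set {set T}}) (d : nat).
Hypothesis uniformF : uniform F d.+1.

Definition nb (D : {set T}) := [set z in ~: D | z |: D \in F].

Definition unowned := [set G in F | [forall z in G, #|nb (G :\ z)| != 1]].

Lemma nbE D z : (z \in nb D) = (z \notin D) && (z |: D \in F).
Proof. by rewrite !inE. Qed.

Lemma mem_nb_setD1 G z : G \in F -> z \in G -> z \in nb (G :\ z).
Proof. by move=> GF zG; rewrite nbE !inE eqxx setD1K. Qed.

Lemma card_nb_leq (D : {set T}) : #|D| = d -> #|nb D| <= #|T| - d.
Proof.
move=> <-; rewrite (_ : #|T| - #|D| = #|~: D|); last by rewrite -(cardsC D) addKn.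
apply: subset_leq_card.
by apply/subsetP => z; rewrite nbE inE => /andP[].
Qed.

Lemma sum_nb : \sum_(D : {set T} | #|D| == d) #|nb D| = d.+1 * #|F|.
Proof.
rewrite -sum1_card [in RHS](eq_bigl (fun G : {set T} => (#|G| == d.+1) && (G \in F))); last first.
  by move=> G; rewrite andbC; case GF: (G \in F) => //=; rewrite (uniformF GF) eqxx.
rewrite big_mkcondr -(sum_cover (fun G => if G \in F then 1 else 0)).
apply: eq_bigr => D _; rewrite -sum1_card -big_mkcondr /=.
by apply: eq_bigl => z; rewrite nbE inE.
Qed.

Lemma card_owned :
  #|F :\: unowned| <= \sum_(D : {set T} | #|D| == d) (#|nb D| == 1).
Proof.
rewrite -sum1_card.
apply: (@leq_trans (\sum_(G in F) \sum_(z in G) (#|nb (G :\ z)| == 1))).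
  rewrite [X in _ <= X](bigID (fun G => G \in unowned)) /=.
  rewrite (leq_trans _ (leq_addl _ _)) //.
  rewrite (eq_bigl (fun G : {set T} => (G \in F) && (G \notin unowned))); last first.
    by move=> G; rewrite !inE andbC.
  apply: leq_sum => G /andP[GF]; rewrite inE GF /= => /forall_inPn[z zG].
  by rewrite negbK (bigD1 z) //= => ->.
rewrite big_mkcond /= (eq_bigr (fun G : {set T} => \sum_(z in G)
   (z |: (G :\ z) \in F) * (#|nb (G :\ z)| == 1))); last first.
  move=> G _; case: ifP => GF.
    by apply: eq_bigr => z zG; rewrite setD1K // GF mul1n.
  by rewrite big1 // => z zG; rewrite setD1K // GF.
rewrite -(sum_setC_setD1 (fun D z => (z |: D \in F) * (#|nb D| == 1))).
rewrite [X in _ <= X]big_mkcond /=; apply: leq_sum => D _.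
rewrite -big_distrl /= -big_mkcondr sum1_card /=.
have -> : #|[pred z in ~: D | z |: D \in F]| = #|nb D|.
  by apply: eq_card => z; rewrite !inE.
case: eqP => [nb1|_]; last by rewrite muln0.
have [z] : exists z, z \in nb D by apply/card_gt0P; rewrite nb1.
rewrite nbE => /andP[zD /uniformF]; rewrite cardsU1 zD nb1 => -[].
by rewrite add0n => ->; rewrite eqxx.
Qed.

(** Over all [d]-sets, degree plus defect sums to [n * 'C(n.-1, d)], where [n = #|T|]. The degrees
    sum to [d.+1 * #|F|], and each owned member has its own set of degree 1, whose defect [n - d.+1]
    raises the weight of the member from [d.+1] to [n]. *)
Lemma count_unowned : d < #|T| ->
  #|T| * #|F :\: unowned| + d.+1 * #|unowned|
    + \sum_(D : {set T} | (#|D| == d) && (#|nb D| != 1)) (#|T| - d - #|nb D|)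
  <= #|T| * 'C(#|T|.-1, d).
Proof.
move=> dT.
have cardF : #|F :\: unowned| + #|unowned| = #|F|.
  have sub : unowned \subset F by apply/subsetP => G; rewrite inE => /andP[].
  by rewrite cardsD (setIidPr sub) subnK // subset_leq_card.
have := sum_nb; have := card_owned; rewrite -cardF.
set x := #|_ :\: _|; set y := #|unowned|; set o := \sum_(_ | _) (_ == _).
set s := \sum_(_ | _) #|_|; set S := \sum_(_ | _) _ => xo es.
have : s + (#|T| - d.+1) * o + S = #|T| * 'C(#|T|.-1, d).
  rewrite mul_bin_diag mul_bin_left [in RHS]mulnC -card_draws -sum_nat_const.
  rewrite [RHS](eq_bigl (fun D : {set T} => #|D| == d)) => [|D]; last by rewrite inE.
  rewrite /s /S /o big_distrr /= -addnA big_mkcondr -!big_split /=.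
  apply: eq_bigr => D /eqP Dd; have := card_nb_leq Dd.
  by case: eqP; rewrite /=; lia.
nia.
Qed.

Lemma card_nb_unowned G z : G \in unowned -> z \in G -> 1 < #|nb (G :\ z)|.
Proof.
rewrite inE => /andP[GF /forall_inP/(_ z)] nz zG.
have: 0 < #|nb (G :\ z)| by apply/card_gt0P; exists z; rewrite mem_nb_setD1.
by move: (nz zG); case: #|_| => [|[]].
Qed.

(** * Missing traces and branching *)

Hypothesis VCF : VCdim_le F d.

(** Otherwise [F] would shatter [G], which has [d.+1] elements. *)
Lemma not_trace G : G \in F ->
  exists2 B : {set T}, B \subset G & forall H, H \in F -> H :&: G != B.
Proof.
move=> GF; case: (boolP [exists B : {set T}, (B \subset G) && [forall H in F, H :&: G != B]]).
  by case/existsP=> B /andP[BG /forall_inP]; exists B.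
rewrite negb_exists => /forallP nB.
have /VCF : shatters F G.
  move=> B BG; have := nB B; rewrite BG /= => /forall_inPn[H HF].
  by rewrite negbK => /eqP; exists H.
by rewrite (uniformF GF) ltnn.
Qed.

(** The choice depends on [P] alone, so branching points can be enumerated without knowing [G]; the
    default [set0] respects the size bound. *)
Definition pickF (P : pred {set T}) := odflt set0 [pick H in F | P H].

Lemma pickFP (P : pred {set T}) H : H \in F -> P H -> (pickF P \in F) /\ P (pickF P).
Proof.
rewrite /pickF => HF PH; case: pickP => [K /andP[]//|/(_ H)].
by rewrite HF PH.
Qed.

Lemma card_pickF P : #|pickF P| <= d.+1.
Proof.
rewrite /pickF; case: pickP => [K /andP[/uniformF -> _]|_] //=.
by rewrite cards0.
Qed.

Definition dominated G x y :=
  [forall H in F, (G :\ x :\ y \subset H) ==> (x \in H) || (y \in H)].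

Let g0 (B : {set T}) := pickF (fun H => B \subset H).
Let g1 (B : {set T}) x := pickF (fun H => (B \subset H) && (x \notin H)).
Let g2 (B : {set T}) x y := pickF (fun H => [&& B \subset H, x \notin H & y \notin H]).

(* [x] is picked in a member above [B], [y] in a member above [B] avoiding [x]
   (it exists since [G] is unowned); so few [G] share given [B] and [G :\ x :\ y]. *)
Lemma unowned_branch G : G \in unowned -> exists (B : {set T}) x y,
  [/\ B \subset G :\ x :\ y, x \in G, y \in G :\ x, x \in g0 B & y \in g1 B x]
  /\ forall H, H \in F -> B \subset H -> exists2 z, z \in G :\: B & z \in H.
Proof.
move=> GY; have GF : G \in F by move: GY; rewrite inE => /andP[].
have [B BG nB] := not_trace GF.
have meet H : H \in F -> B \subset H -> exists2 z, z \in G :\: B & z \in H.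
  move=> HF BH; have /subsetPn[z] : ~~ (H :&: G \subset B).
    by apply: contra (nB _ HF) => sub; rewrite eqEsubset sub subsetI BH BG.
  by rewrite inE => /andP[zH zG] zB; exists z; rewrite // inE zB zG.
have [g0F Bg0] := pickFP (P := fun H => B \subset H) GF BG.
have [x] := meet _ g0F Bg0; rewrite inE => /andP[xB xG] xg0.
have BGx : B \subset G :\ x by rewrite subsetD1 BG xB.
have [H HF /andP[BH xH]] : exists2 H, H \in F & (B \subset H) && (x \notin H).
  have /card_gt1P[z [w [zN wN zw]]] := card_nb_unowned GY xG.
  wlog zx : z w zN wN zw / z != x.
    move=> hwlog; case: (eqVneq z x) => [zx|]; last exact: hwlog zw.
    by apply: (hwlog w z) => //; rewrite -?zx eq_sym.
  move: zN; rewrite nbE => /andP[zG zF]; exists (z |: G :\ x) => //.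
  by rewrite (subset_trans BGx (subsetUr _ _)) !inE eq_sym (negPf zx) eqxx.
have [g1F /andP[Bg1 xg1]] :=
  pickFP (P := fun H => (B \subset H) && (x \notin H)) HF (introT andP (conj BH xH)).
have [y] := meet _ g1F Bg1; rewrite inE => /andP[yB yG] yg1.
have yx : y != x by apply: contraTneq yg1 => ->.
exists B, x, y; split=> //; split=> //; last by rewrite !inE yx.
by rewrite subsetD1 BGx.
Qed.

(** By [unowned_branch], [G] is recovered from the [d.-1] points left without [x] and [y], a subset
    [B] of them, and one point from each of two picked sets of size at most [d.+1]. *)
Lemma card_unowned :
  #|unowned| <= 'C(#|T|, d.-1) * (2 ^ d.-1 * (d.+1 * d.+1)).
Proof.
pose U := \bigcup_(S in [set S : {set T} | #|S| == d.-1]) \bigcup_(B in powerset S)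
  \bigcup_(x in g0 B) \bigcup_(y in g1 B x) [set x |: (y |: S)].
apply: (@leq_trans #|U|).
  apply: subset_leq_card; apply/subsetP => G GY.
  have [B [x [y [[BG xG yG xg yg] _]]]] := unowned_branch GY.
  have /uniformF cG : G \in F by move: GY; rewrite inE => /andP[].
  apply/bigcupP; exists (G :\ x :\ y).
    by rewrite inE; move: cG; rewrite (cardsD1 x) xG (cardsD1 y (G :\ x)) yG => -[<-].
  apply/bigcupP; exists B; first by rewrite inE.
  apply/bigcupP; exists x => //; apply/bigcupP; exists y => //.
  by rewrite inE !setD1K.
rewrite -card_draws; apply: card_bigcup_leq => S; rewrite inE => /eqP <-.
rewrite -card_powerset.
apply: card_bigcup_leq => B _.
apply: leq_trans (_ : #|g0 B| * d.+1 <= _); last by rewrite leq_mul2r card_pickF orbT.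
apply: card_bigcup_leq => x _.
apply: leq_trans (_ : #|g1 B x| * 1 <= _); last by rewrite muln1 card_pickF.
by apply: card_bigcup_leq => y _; rewrite cards1.
Qed.

(** * Good members, their bases and tips *)

Definition good := [set G in unowned |
  [exists x in G, exists y in G :\ x, dominated G x y]].

(** When [x] and [y] do not dominate, some member above [B] avoids both, and the branching reaches a
    third point [z] of [G]. Only [d - 2] points of [G] remain free. *)
Lemma card_exceptional :
  #|unowned :\: good| <= 'C(#|T|, d - 2) * (2 ^ (d - 2) * (d.+1 * (d.+1 * d.+1))).
Proof.
pose U := \bigcup_(S in [set S : {set T} | #|S| == d - 2]) \bigcup_(B in powerset S)
  \bigcup_(x in g0 B) \bigcup_(y in g1 B x) \bigcup_(z in g2 B x y)
    [set x |: (y |: (z |: S))].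
apply: (@leq_trans #|U|).
  apply: subset_leq_card; apply/subsetP => G; rewrite inE => /andP[nG GY].
  have [B [x [y [[BG xG yG xg yg] meet]]]] := unowned_branch GY.
  have /uniformF cG : G \in F by move: GY; rewrite inE => /andP[].
  have /forall_inPn[H HF] : ~~ dominated G x y.
    apply: contra nG => dG; rewrite inE GY.
    by apply/exists_inP; exists x => //; apply/exists_inP; exists y.
  rewrite negb_imply negb_or => /andP[GH /andP[xH yH]].
  have [g2F /and3P[Bg2 xg2 yg2]] := pickFP
    (P := fun H => [&& B \subset H, x \notin H & y \notin H]) HF
    (introT and3P (And3 (subset_trans BG GH) xH yH)).
  have [z] := meet _ g2F Bg2; rewrite inE => /andP[zB zG] zg2.
  have zG' : z \in G :\ x :\ y.
    by rewrite !inE zG andbT; apply/andP; split; apply: contraTneq zg2 => ->.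
  apply/bigcupP; exists (G :\ x :\ y :\ z).
    rewrite inE; move: cG; rewrite (cardsD1 x) xG (cardsD1 y (G :\ x)) yG.
    by rewrite (cardsD1 z (G :\ x :\ y)) zG' => -[<-]; rewrite !add1n subn2.
  apply/bigcupP; exists B; first by rewrite inE subsetD1 BG.
  apply/bigcupP; exists x => //; apply/bigcupP; exists y => //.
  by apply/bigcupP; exists z => //; rewrite inE !setD1K.
rewrite -card_draws; apply: card_bigcup_leq => S; rewrite inE => /eqP <-.
rewrite -card_powerset.
apply: card_bigcup_leq => B _.
apply: leq_trans (_ : #|g0 B| * (d.+1 * d.+1) <= _); last by rewrite leq_mul2r card_pickF orbT.
apply: card_bigcup_leq => x _.
apply: leq_trans (_ : #|g1 B x| * d.+1 <= _); last by rewrite leq_mul2r card_pickF orbT.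
apply: card_bigcup_leq => y _.
apply: leq_trans (_ : #|g2 B x y| * 1 <= _); last by rewrite muln1 card_pickF.
by apply: card_bigcup_leq => z _; rewrite cards1.
Qed.

(** [pick] fixes one dominating pair, so a good member has a single base, as [mutual_apex] requires.
    The default [G] never occurs for a good member. *)
Definition base (G : {set T}) :=
  if [pick p : T * T | [&& p.1 \in G, p.2 \in G :\ p.1 & dominated G p.1 p.2]]
    is Some p then G :\ p.1 :\ p.2 else G.

Definition over (B : {set T}) := [set G in good | base G == B].

Definition tips (B : {set T}) := \bigcup_(G in over B) (G :\: B).

Lemma over_unowned B G : G \in over B -> G \in unowned.
Proof. by rewrite !inE => /andP[/andP[]]. Qed.

Lemma over_F B G : G \in over B -> G \in F.
Proof. by move=> /over_unowned; rewrite inE => /andP[]. Qed.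

Lemma tipsP B v : v \in tips B ->
  exists2 G, G \in over B & v \in G :\: B.
Proof. by move/bigcupP => [G GB vG]; exists G. Qed.

Lemma overP B G : G \in over B -> exists x y,
  [/\ x \notin B, y \notin x |: B, G = y |: (x |: B), #|B|.+1 = d
    & forall H, H \in F -> B \subset H -> (x \in H) || (y \in H)].
Proof.
move=> GB; have cG := uniformF (over_F GB).
move: GB; rewrite inE => /andP[gG /eqP].
have : exists p : T * T, [&& p.1 \in G, p.2 \in G :\ p.1 & dominated G p.1 p.2].
  move: gG; rewrite inE => /andP[_ /exists_inP[x xG /exists_inP[y yG dG]]].
  by exists (x, y); rewrite /= xG yG.
rewrite /base; case: pickP => [[x y] /= /and3P[xG yG dG] _|no [p]]; last by rewrite no.
move=> defB; have Gxy : G = y |: (x |: B) by rewrite setUCA -defB !setD1K.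
have xB : x \notin B by rewrite -defB !inE eqxx andbF.
have yxB : y \notin x |: B.
  rewrite !inE -defB !inE eqxx /= orbF.
  by move: yG; rewrite inE => /andP[]; rewrite inE.
exists x, y; split=> //; first by move: cG; rewrite Gxy !cardsU1 xB yxB => -[].
by move=> H' HF BH; move/forall_inP/(_ H' HF)/implyP: dG; rewrite defB; apply.
Qed.

Lemma overP_at B G v : G \in over B -> v \in G :\: B ->
  exists w, [/\ v \notin B, w \notin v |: B, G = w |: (v |: B)
    & forall H, H \in F -> B \subset H -> (v \in H) || (w \in H)].
Proof.
move=> /overP[x [y [xB yB -> _ dom]]].
rewrite !inE => /andP[vB]; rewrite (negPf vB) orbF => /orP[]/eqP ->; last by exists y.
move: yB; rewrite !inE negb_or => /andP[yx yB].
exists x; split=> //; last by move=> H HF BH; rewrite orbC dom.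
  by rewrite !inE negb_or eq_sym yx xB.
by rewrite setUCA.
Qed.

Lemma card_over_setD B G : G \in over B -> #|G :\: B| = 2.
Proof.
move=> /overP[x [y [xB yB -> _ _]]].
have -> : (y |: (x |: B)) :\: B = [set y; x].
  apply/setP => z; rewrite !inE; case: eqP => [->|_] /=.
    by move: yB; rewrite !inE negb_or => /andP[_ ->].
  by case: eqP => [->|_] /=; rewrite ?xB ?andNb.
by rewrite cards2; move: yB; rewrite !inE negb_or => /andP[->].
Qed.

Lemma tip_over B G v : G \in over B -> v \in G -> v \notin B -> v \in tips B.
Proof. by move=> GB vG vB; apply/bigcupP; exists G; rewrite // inE vB. Qed.

Lemma tips_card B v : v \in tips B -> #|B|.+1 = d.
Proof. by case/tipsP=> G GB _; case/overP: GB => x [y []]. Qed.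

Lemma tips_notin B v : v \in tips B -> v \notin B.
Proof. by case/tipsP=> G GB /(overP_at GB)[w []]. Qed.

Lemma tips_nb B v : v \in tips B -> 1 < #|nb (v |: B)|.
Proof.
case/tipsP=> G GB /(overP_at GB)[w [vB wB defG _]].
have -> : v |: B = G :\ w by rewrite defG setU1K.
by rewrite card_nb_unowned ?(over_unowned GB) // defG setU11.
Qed.

(** A member above [v |: B] contains one of the two points of [G :\: B]; as [v] is neither, the
    added point is. *)
Lemma nb_tip_missed B v G : v \in tips B -> G \in over B -> v \notin G ->
  nb (v |: B) \subset G :\: B /\ #|nb (v |: B)| <= 2.
Proof.
move=> vB GB vG; have bv := tips_notin vB.
have [x [y [xB yB defG _ dom]]] := overP GB.
have sub : nb (v |: B) \subset G :\: B.
  apply/subsetP => z; rewrite nbE => /andP[zvB /dom].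
  rewrite (subset_trans (subsetUr [set v] B) (subsetUr _ _)) => /(_ isT).
  move: vG zvB yB; rewrite defG !inE !negb_or (negPf xB).
  move=> /and3P[/negPf vy /negPf vx _] /andP[zv zB] /andP[yx /negPf yB].
  rewrite yB (eq_sym x v) (eq_sym y v) vx vy !orbF (eq_sym x z) (eq_sym y z) zB.
  by rewrite orbCA orbA => ->.
by split=> //; rewrite -(card_over_setD GB) subset_leq_card.
Qed.

(** Fix a member with tips [a] and [b]. By domination, every member over [B] contains one of them.
    If it consists of [a] and some [v != b] besides [B], its dominating pair also meets the member
    formed by [b |: B] and a neighbour [ha != a], which forces [v = ha]; the case of [b] is
    symmetric. *)
Lemma card_tips B : #|tips B| <= 4.
Proof.
have [->|[a]] := set_0Vmem (tips B); first by rewrite cards0.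
case/tipsP=> G GB aG; have [b [aB bB defG dom]] := overP_at GB aG.
have GY := over_unowned GB.
have bB' : b \notin B by move: bB; rewrite inE negb_or => /andP[].
have ab : b != a by move: bB; rewrite !inE negb_or => /andP[].
have aT : a \in tips B by apply/bigcupP; exists G.
have bT : b \in tips B by rewrite (tip_over GB) // defG setU11.
have other u w : w \in tips B -> exists2 h, h \in nb (w |: B) & h != u.
  move=> /tips_nb; rewrite (cardsD1 u) => gt1.
  have /card_gt0P[h] : 0 < #|nb (w |: B) :\ u| by move: gt1; case: (u \in _) => // /ltnW.
  by rewrite in_setD1 => /andP[hu hN]; exists h.
have [ha haN haa] := other a b bT; have [hb hbN hbb] := other b a aT.
have sub : tips B \subset [set a; b] :|: [set ha; hb].
  apply/subsetP => v /tipsP[K KB vK].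
  have [w [vB wB defK domK]] := overP_at KB vK.
  have : (a \in K) || (b \in K).
    by apply: dom (over_F KB) _; rewrite defK setUA subsetUr.
  rewrite defK !inE (negPf aB) (negPf bB') !orbF.
  rewrite (eq_sym a v) (eq_sym b v).
  case: (eqVneq v a) => //= va; case: (eqVneq v b) => //= vb.
  rewrite !orbF => /orP[]/eqP wE; rewrite -{}wE in domK.
    move: haN; rewrite nbE => /andP[hB /domK].
    rewrite (subset_trans (subsetUr [set b] B) (subsetUr _ _)) => /(_ isT).
    by rewrite !inE (negPf vb) (negPf vB) (negPf aB) (eq_sym a ha) (negPf haa)
      (eq_sym a b) (negPf ab) !orbF => ->.
  move: hbN; rewrite nbE => /andP[hB /domK].
  rewrite (subset_trans (subsetUr [set a] B) (subsetUr _ _)) => /(_ isT).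
  by rewrite !inE (negPf va) (negPf vB) (negPf bB') (eq_sym b hb) (negPf hbb)
     (negPf ab) !orbF => ->; rewrite orbT.
apply: leq_trans (subset_leq_card sub) _; apply: leq_trans (leq_card_setU _ _) _.
by rewrite !cards2; do 2!case: (_ != _).
Qed.

(** * Defects paid at the tips of a base *)

Definition defect (D : {set T}) := #|T| - d - #|nb D|.

Definition twos (B : {set T}) := [set z in ~: B | #|nb (z |: B)| == 2].

Lemma card_over_through B v : v \in tips B ->
  #|[set G in over B | v \in G]| <= #|nb (v |: B)|.
Proof.
move=> vB; have bv := tips_notin vB.
have sub : [set G in over B | v \in G] \subset
    (fun z => z |: (v |: B)) @: nb (v |: B).
  apply/subsetP => G; rewrite inE => /andP[GB vG].
  have vGB : v \in G :\: B by rewrite inE bv.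
  have [w [_ wB defG _]] := overP_at GB vGB.
  by apply/imsetP; exists w; rewrite // nbE wB -defG (over_F GB).
exact: leq_trans (subset_leq_card sub) (leq_imset_card _ _).
Qed.

(* [over B], minus [B], is a set of pairwise meeting pairs, i.e. a star or a
   triangle; only the centre of a star can have a large link. *)
Lemma card_over_tips B : 1 < #|over B| ->
  #|over B| <= #|[set v in tips B | #|nb (v |: B)| <= 2]|.
Proof.
move=> gt1; set U := [set v in _ | _].
case: (boolP [exists y in tips B, [forall G in over B, y \in G]]).
  case/exists_inP=> y yB /forall_inP yG.
  have sub : over B \subset (fun v => v |: (y |: B)) @: U.
    apply/subsetP => G GB.
    have yB' := tips_notin yB.
    have [w [_ wB defG _]] := overP_at GB (introT setDP (conj (yG _ GB) yB')).
    have wT : w \in tips B.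
      by rewrite (tip_over GB) ?defG ?setU11 //; move: wB; rewrite inE negb_or => /andP[].
    apply/imsetP; exists w => //; rewrite inE wT /=.
    have [K KB KG] : exists2 K, K \in over B & K != G.
      have /card_gt1P[K [L [KB LB KL]]] := gt1.
      by case: (eqVneq K G) => [<-|KG]; [exists L; rewrite // eq_sym | exists K].
    (* A second member containing both the centre [y] and [w] would equal [G]. *)
    have wK : w \notin K.
      apply: contra KG => wK; rewrite eq_sym eqEcard.
      rewrite (uniformF (over_F GB)) (uniformF (over_F KB)) leqnn andbT defG.
      rewrite !subUset !sub1set wK yG //=.
      by have [x [y' [_ _ -> _ _]]] := overP KB; rewrite setUA subsetUr.
    by have [] := nb_tip_missed wT KB wK.
  exact: leq_trans (subset_leq_card sub) (leq_imset_card _ _).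
(* Without a centre every tip is missed by some member, so all links have size at most 2. Each
   member then has two tips and each tip lies in at most two members. *)
move=> no; have UE : U = tips B.
  apply/setP => v; rewrite inE andb_idr // => vB.
  have /forall_inPn[G GB vG] : ~~ [forall G in over B, v \in G].
    by apply: contra no => all; apply/exists_inP; exists v.
  by have [] := nb_tip_missed vB GB vG.
rewrite -(leq_pmul2l (isT : 0 < 2)) UE.
apply: (@leq_trans (\sum_(G in over B) \sum_(v in tips B) (v \in G))).
  rewrite mulnC -sum_nat_const; apply: leq_sum => G GB.
  rewrite -(card_over_setD GB) -sum1_card [X in _ <= X](bigID (mem G)) /=.
  rewrite (leq_trans _ (leq_addr _ _)) // big_mkcond [X in _ <= X]big_mkcond /=.
  apply: leq_sum => v _; rewrite inE; case: ifP => // /andP[vB vG].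
  by rewrite vG (tip_over GB).
rewrite exchange_big /= mulnC -sum_nat_const; apply: leq_sum => v vB.
rewrite -big_mkcondr sum1_card.
have -> : #|[pred G in over B | v \in G]| = #|[set G in over B | v \in G]|.
  by apply: eq_card => G; rewrite !inE.
apply: leq_trans (card_over_through vB) _.
by move: vB; rewrite -UE inE => /andP[].
Qed.

(** With several members over [B], [card_over_tips] gives as many tips of degree at most 2, hence of
    defect at least [#|T| - d - 2]. With a single member, the two links lie outside [B] and overlap
    only in [twos B], so the two defects add up to [#|T| - d] up to a loss of [1 + #|twos B|]. *)
Lemma sum_defect_tips B :
  (#|T| - d) * #|over B|
    <= \sum_(v in tips B) defect (v |: B) + 3 * #|over B| + #|twos B|.
Proof.
case: (leqP #|over B| 1) => [le1|gt1]; last first.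
  have : (#|T| - d - 2) * #|over B| <= \sum_(v in tips B) defect (v |: B).
    apply: leq_trans (leq_mul (leqnn _) (card_over_tips gt1)) _.
    rewrite mulnC -sum_nat_const [X in _ <= X](bigID (fun v => #|nb (v |: B)| <= 2)) /=.
    rewrite (leq_trans _ (leq_addr _ _)) //.
    rewrite (eq_bigl (fun v => (v \in tips B) && (#|nb (v |: B)| <= 2))) => [|v]; last by rewrite inE.
    by apply: leq_sum => v /andP[_ v2]; rewrite /defect leq_sub2l.
  nia.
case: (posnP #|over B|) => [->|gt0]; first by rewrite muln0.
have /cards1P[G defO] : #|over B| == 1 by rewrite eqn_leq le1.
have GB : G \in over B by rewrite defO set11.
have [x [y [xB yB defG cB dom]]] := overP GB.
have yx : y != x by move: yB; rewrite !inE negb_or => /andP[].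
have yB' : y \notin B by move: yB; rewrite !inE negb_or => /andP[].
have -> : \sum_(v in tips B) defect (v |: B) = defect (y |: B) + defect (x |: B).
  have -> : tips B = y |: [set x].
    apply/setP => z; rewrite /tips defO big_set1 defG !inE.
    by case: eqP => [->|_]; rewrite ?yB' //; case: eqP => [->|_]; rewrite ?xB ?andNb.
  by rewrite big_setU1 /= ?big_set1 // inE.
have cU : #|nb (x |: B) :|: nb (y |: B)| <= #|T| - #|B|.
  rewrite (_ : #|T| - #|B| = #|~: B|); last by rewrite -(cardsC B) addKn.
  apply: subset_leq_card; apply/subsetP => z; rewrite !inE !negb_or.
  by case/orP=> /andP[/andP[_ ->]].
have cI : #|nb (x |: B) :&: nb (y |: B)| <= #|twos B|.
  apply: subset_leq_card; apply/subsetP => z; rewrite in_setI !nbE.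
  case/andP=> /andP[zx xF] /andP[zy yF]; move: zx zy; rewrite !inE !negb_or.
  move=> /andP[/negPf zx zB] /andP[/negPf zy _]; rewrite zB /=.
  (* Domination by [x] and [y] leaves no third neighbour of [z |: B]. *)
  have -> : nb (z |: B) = [set y; x].
    apply/setP => w; rewrite nbE in_set2; apply/andP/orP => [[wzB /dom]|[]/eqP->].
    - rewrite (subset_trans (subsetUr [set z] B) (subsetUr _ _)) => /(_ isT).
      rewrite !inE (negPf xB) (negPf yB') (eq_sym x z) (eq_sym y z) zx zy !orbF.
      by rewrite (eq_sym x) (eq_sym y) => /orP[]; [right|left].
    - by rewrite setUCA yF !inE (eq_sym y z) zy yB'.
    by rewrite setUCA xF !inE (eq_sym x z) zx xB.
  by rewrite cards2 yx.
have := cardsUI (nb (x |: B)) (nb (y |: B)).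
have := card_nb_leq (_ : #|x |: B| = d); rewrite cardsU1 xB add1n => /(_ cB).
have := card_nb_leq (_ : #|y |: B| = d); rewrite cardsU1 yB' add1n => /(_ cB).
rewrite defO cards1 /defect; lia.
Qed.

(** * Mutual tips and sets of degree 0 *)

Lemma mem_mutual A p : p \in mutual (fun v => tips (v |: A)) ->
  [/\ p.1 \notin A, p.2 \notin A, p.1 != p.2 & #|A|.+2 = d].
Proof.
case: p => v u; rewrite inE /= => /andP[uv vu].
have := tips_card uv; have := tips_notin uv; have := tips_notin vu.
rewrite !inE !negb_or => /andP[vu' vA] /andP[_ uA].
by rewrite cardsU1 vA.
Qed.

(** A member over [v |: A] through [u] and one over [u |: A] through [v] each have one point beyond
    [v], [u] and [A]. If these points agreed, a single member would have two different bases. *)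
Lemma mutual_apex A v u : (v, u) \in mutual (fun v => tips (v |: A)) ->
  exists x y,
  [/\ x != y, x \in tips (v |: A), y \in tips (u |: A),
      forall H, H \in F -> v |: A \subset H -> (u \in H) || (x \in H)
    & forall H, H \in F -> u |: A \subset H -> (v \in H) || (y \in H)].
Proof.
move=> vu; have [/= vA uA vDu _] := mem_mutual vu.
move: vu; rewrite inE /= => /andP[/tipsP[G GB uG] /tipsP[K KB vK]].
have [x [_ xB defG domG]] := overP_at GB uG.
have [y [_ yB defK domK]] := overP_at KB vK.
exists x, y; split=> //.
- apply: contraNneq uA => xy; have GK : G = K by rewrite defG defK xy (setUCA [set u]).
  have : base G = u |: A by apply/eqP; rewrite GK; move: KB; rewrite inE => /andP[].
  have -> : base G = v |: A by apply/eqP; move: GB; rewrite inE => /andP[].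
  by move/setP/(_ u); rewrite !inE eqxx (eq_sym u v) (negPf vDu).
- by rewrite (tip_over GB) ?defG ?setU11 //; move: xB; rewrite inE negb_or => /andP[].
- by rewrite (tip_over KB) ?defK ?setU11 //; move: yB; rewrite inE negb_or => /andP[].
Qed.

(** A neighbour [w] of [v |: (u |: A)] must lie in both dominating pairs, that of [v'] and [x] and
    that of [u'] and [y]; the inequalities leave only [w = x = y]. *)
Lemma common_apex (A : {set T}) v v' x u u' y :
    (forall H, H \in F -> v |: A \subset H -> (v' \in H) || (x \in H)) ->
    (forall H, H \in F -> u |: A \subset H -> (u' \in H) || (y \in H)) ->
    v' \notin v |: (u |: A) -> x \notin v |: (u |: A) ->
    u' \notin v |: (u |: A) -> y \notin v |: (u |: A) ->
    u' != v' -> u' != x -> v' != y ->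
  nb (v |: (u |: A)) != set0 -> x = y.
Proof.
move=> domv domu v'D xD u'D yD uv ux vy /set0Pn[w]; rewrite nbE => /andP[wD HF].
have sub1 : v |: A \subset w |: (v |: (u |: A)).
  by rewrite (setUCA [set v]) setUA subsetUr.
have sub2 : u |: A \subset w |: (v |: (u |: A)).
  by rewrite setUA subsetUr.
have := domv _ HF sub1; have := domu _ HF sub2.
rewrite !(in_setU1 _ w) (negPf v'D) (negPf xD) (negPf u'D) (negPf yD) !orbF.
move=> /orP[/eqP u'w|/eqP yw] /orP[/eqP v'w|/eqP xw].
- by rewrite u'w v'w eqxx in uv.
- by rewrite u'w xw eqxx in ux.
- by rewrite v'w yw eqxx in vy.
by rewrite xw yw.
Qed.

Definition zero (A : {set T}) a b :=
  [&& b \notin A, a \notin b |: A & nb (a |: (b |: A)) == set0].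

(* If both links were nonempty, the apex of [p.1] would coincide with both apices
   of [q], which are distinct. *)
Lemma mutual_zero A p q :
    let P := mutual (fun v => tips (v |: A)) in
    let near p := tips (p.1 |: A) :|: tips (p.2 |: A) in
    p \in P -> q \in P -> q.1 \notin near p -> q.2 \notin near p ->
    p.1 \notin near q -> p.2 \notin near q ->
  zero A p.1 q.1 || zero A p.1 q.2.
Proof.
case: p q => v v' [u u'] P near pP qP /=.
have [/= vA v'A vDv' _] := mem_mutual pP; have [/= uA u'A uDu' _] := mem_mutual qP.
have [x [x' [_ xT x'T domv _]]] := mutual_apex pP.
have [y [y' [yy' yT y'T domu domu']]] := mutual_apex qP.
have [v'T vT] : v' \in tips (v |: A) /\ v \in tips (v' |: A).
  by move: pP; rewrite inE => /andP[].
have [u'T uT] : u' \in tips (u |: A) /\ u \in tips (u' |: A).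
  by move: qP; rewrite inE => /andP[].
have sep (a b : T) (S : {set T}) : a \notin S -> b \in S -> a != b.
  by move=> aS bS; apply: contraNneq aS => ->.
rewrite /near !in_setU !negb_or /=.
move=> /andP[u1 u2] /andP[u'1 u'2] /andP[v1 v2] /andP[v'1 v'2].
rewrite /zero uA u'A !in_setU1 (negPf vA) !orbF /=.
rewrite (sep _ _ _ v2 uT) (sep _ _ _ v1 u'T) /=.
apply: contraT; rewrite negb_or => /andP[nz nz'].
have xn : x \notin v |: A := tips_notin xT.
have yn : y \notin u |: A := tips_notin yT.
have y'n : y' \notin u' |: A := tips_notin y'T.
move: xn yn y'n; rewrite !in_setU1 !negb_or => /andP[xv xA] /andP[yu yA] /andP[yu' y'A].
have xy : x = y.
  apply: common_apex domv domu _ _ _ _ _ _ _ nz; rewrite ?in_setU1 ?negb_or;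
    rewrite ?vA ?v'A ?u'A ?xA ?yA ?andbT ?yu ?xv /=.
  - by rewrite eq_sym vDv' (sep _ _ _ v'2 uT).
  - by rewrite eq_sym (sep _ _ _ u1 xT).
  - by rewrite (eq_sym u' u) uDu' (sep _ _ _ u'2 vT).
  - by rewrite eq_sym (sep _ _ _ v1 yT).
  - exact: sep u'1 v'T.
  - exact: sep u'1 xT.
  exact: sep v'1 yT.
have xy' : x = y'.
  apply: common_apex domv domu' _ _ _ _ _ _ _ nz'; rewrite ?in_setU1 ?negb_or;
    rewrite ?vA ?v'A ?uA ?xA ?y'A ?andbT ?yu' ?xv /=.
  - by rewrite eq_sym vDv' (sep _ _ _ v'1 u'T).
  - by rewrite eq_sym (sep _ _ _ u'1 xT).
  - by rewrite uDu' (sep _ _ _ u2 vT).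
  - by rewrite eq_sym (sep _ _ _ v2 y'T).
  - exact: sep u1 v'T.
  - exact: sep u1 xT.
  exact: sep v'2 y'T.
by rewrite -xy xy' eqxx in yy'.
Qed.

(** [L] is a free threshold. Up to [128 + L] mutual pairs the first term suffices; for a larger
    number [m], [L * m <= m * (m - 128)], which [card_mutual] bounds. *)
Lemma card_mutual_tips A L :
  L * #|mutual (fun v => tips (v |: A))|
    <= L * (128 + L) + 32 * \sum_a \sum_b zero A a b.
Proof.
have := card_mutual (fun v => card_tips (v |: A)) (@mutual_zero A).
by rewrite expnS expn1; nia.
Qed.

(** * Summation over all bases *)

Lemma sum_zero : 1 < d ->
  \sum_(A : {set T} | #|A| == d - 2) \sum_a \sum_b zero A a b
    = d.-1 * (d * \sum_(D : {set T} | #|D| == d) (nb D == set0)).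
Proof.
move=> d2; pose h (B : {set T}) := \sum_(a in ~: B) (nb (a |: B) == set0 : nat).
have d1 : (d - 2).+1 = d.-1 by lia.
have d0 : d.-1.+1 = d by lia.
transitivity (\sum_(A : {set T} | #|A| == d - 2) \sum_(b in ~: A) h (b |: A)).
  apply: eq_bigr => A _; rewrite exchange_big [RHS]big_mkcond /=.
  apply: eq_bigr => b _; rewrite inE /zero; case: (b \in A) => /=.
    exact: big1.
  by rewrite /h [RHS]big_mkcond; apply: eq_bigr => a _; rewrite in_setC; case: (a \in _).
rewrite sum_cover d1; congr (_ * _).
rewrite /h (sum_cover (fun D => (nb D == set0 : nat))) d0.
by [].
Qed.

Lemma sum_twos :
  0 < d -> \sum_(B : {set T} | #|B| == d.-1) #|twos B|
    = d * \sum_(D : {set T} | #|D| == d) (#|nb D| == 2).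
Proof.
move=> d0; rewrite -[in RHS](prednK d0) -sum_cover.
apply: eq_bigr => B _; rewrite -sum1_card big_mkcond [RHS]big_mkcond /=.
by apply: eq_bigr => z _; rewrite !inE; case: (z \in B) => //=; case: (_ == 2).
Qed.

(* [D] occurs [m = #|M D|] times on the left, and [m <= 1 + m * m.-1]. *)
Lemma sum_tips_mutual :
  \sum_(B : {set T}) \sum_(v in tips B) defect (v |: B)
    <= \sum_(D : {set T} | (#|D| == d) && (1 < #|nb D|)) defect D
       + #|T| * \sum_(A : {set T} | #|A| == d - 2) #|mutual (fun v => tips (v |: A))|.
Proof.
pose M (D : {set T}) := [set v in D | v \in tips (D :\ v)].
have sumM : \sum_(B : {set T}) \sum_(v in tips B) defect (v |: B)
    = \sum_(D : {set T}) #|M D| * defect D.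
  rewrite (eq_bigr (fun B => \sum_(v in ~: B) (v \in tips B) * defect (v |: B))).
    rewrite (sum_setC_setD1 (fun B v => (v \in tips B) * defect (v |: B))) /=.
    apply: eq_bigr => D _; rewrite -sum1_card big_distrl /= big_mkcond [RHS]big_mkcond.
    apply: eq_bigr => v _ /=; rewrite inE; case: ifP => //= vD.
    by rewrite setD1K //; case: (v \in _).
  move=> B _; rewrite big_mkcond [RHS]big_mkcond /=; apply: eq_bigr => v _.
  rewrite inE; case: ifP => [vB|_]; last by rewrite mul0n; case: ifP.
  by rewrite (tips_notin vB) mul1n.
(* Two distinct points [v], [u] of [M D] form a mutual pair over [D] without both; peeling off first
   [v], then [u], turns the sum into one over these smaller sets [A]. *)
have sumMM : \sum_(D : {set T}) \sum_(v in M D) #|M D :\ v|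
    <= \sum_(A : {set T} | #|A| == d - 2) #|mutual (fun v => tips (v |: A))|.
  pose f1 (B : {set T}) v :=
    \sum_(u in B) (v \in tips B) * (u \in tips ((v |: B) :\ u)).
  pose f2 (A : {set T}) u := \sum_(v in ~: (u |: A))
    (v \in tips (u |: A)) * (u \in tips ((v |: (u |: A)) :\ u)).
  rewrite (eq_bigr (fun D : {set T} => \sum_(v in D) f1 (D :\ v) v)).
    rewrite -(sum_setC_setD1 f1) (eq_bigr (fun B : {set T} => \sum_(u in B) f2 (B :\ u) u)).
      rewrite -(sum_setC_setD1 f2) [X in _ <= X]big_mkcond.
      apply: leq_sum => A _; case: ifP => [_|dA]; last first.
        rewrite leqn0; apply/eqP; apply: big1 => u; rewrite inE => uA.
        apply: big1 => v; rewrite inE => vuA; apply/eqP; rewrite muln_eq0 !eqb0.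
        rewrite -negb_and; apply: contraFN dA => /andP[/tips_card + _].
        by rewrite cardsU1 uA => <-; rewrite subn2.
      rewrite -sum1_card (eq_bigl (fun p => true && (p.2 \in tips (p.1 |: A))
        && (p.1 \in tips (p.2 |: A)))) => [|p]; last by rewrite inE.
      rewrite big_mkcondr /= -(pair_big_dep predT (fun u v => v \in tips (u |: A))
        (fun u v => if u \in tips (v |: A) then 1 else 0)) /=.
      rewrite big_mkcond; apply: leq_sum => u _; rewrite inE; case: ifP => // uA.
      rewrite /f2 big_mkcond [X in _ <= X]big_mkcond; apply: leq_sum => v _.
      rewrite in_setC; case: ifP => [vuA|_]; last by case: ifP.
      case: (v \in _) => //; rewrite mul1n setUCA setU1K; first by case: (_ \in _).
      by move: vuA; rewrite !inE !negb_or eq_sym uA => /andP[->].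
    move=> B _; rewrite exchange_big /=; apply: eq_bigr => u uB.
    by rewrite /f2 setD1K.
  move=> D _; rewrite big_mkcond [RHS]big_mkcond; apply: eq_bigr => v _.
  rewrite inE; case: ifP => //= [/andP[vD vT]|]; last first.
    case: (v \in D) => //= vT; rewrite /f1 big1 // => u _.
    by rewrite vT.
  rewrite vD /f1 vT setD1K // -sum1_card big_mkcond [RHS]big_mkcond /=.
  apply: eq_bigr => u _; rewrite !inE mul1n; case: (u != v) => //=.
  by case: (u \in D) => //=; case: (_ \in _).
rewrite sumM; apply: leq_trans (_ : _ <=
  \sum_(D : {set T} | (#|D| == d) && (1 < #|nb D|)) defect D
  + #|T| * \sum_(D : {set T}) \sum_(v in M D) #|M D :\ v|) _; last first.
  by rewrite leq_add2l leq_mul2l sumMM orbT.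
rewrite big_distrr [X in _ <= X + _]big_mkcond -big_split /=; apply: leq_sum => D _.
have [->|[v vM]] := set_0Vmem (M D); first by rewrite cards0 mul0n.
have /andP[vD vT] : (v \in D) && (v \in tips (D :\ v)) by move: vM; rewrite inE.
have := tips_nb vT; have := tips_card vT; rewrite setD1K // => cD ->.
rewrite -cD {1}(cardsD1 v D) vD eqxx /=.
have : \sum_(u in M D) #|M D :\ u| = #|M D| * #|M D|.-1.
  rewrite -sum_nat_const; apply: eq_bigr => u uM.
  by rewrite (cardsD1 u (M D)) uM.
move=> ->; have : 0 < #|M D| by apply/card_gt0P; exists v.
have : defect D <= #|T| by rewrite /defect; lia.
case: #|M D| => // m dT _; rewrite mulSn leq_add2l mulnA mulnC leq_mul2r /=.
by rewrite (leq_trans dT) ?leq_pmulr ?orbT.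
Qed.

Lemma card_good :
  #|good| = \sum_(B : {set T} | #|B| == d.-1) #|over B|.
Proof.
rewrite -sum1_card (partition_big base (fun B : {set T} => #|B| == d.-1)) /=.
  by apply: eq_bigr => B _; rewrite -sum1_card; apply: eq_bigl => G; rewrite [in RHS]inE.
move=> G gG; have GB : G \in over (base G) by rewrite inE gG eqxx.
by have [x [y [_ _ _ <- _]]] := overP GB.
Qed.

(** * The bound in natural numbers *)

Lemma card_uniform : 1 < d -> 2 * (d + 2) <= #|T| ->
  #|F| <= 'C(#|T|.-1, d) + (2 ^ (d - 2) * (d.+1 * (d.+1 * d.+1))
    + (2 * d + 3) * (2 ^ d.-1 * (d.+1 * d.+1)) + 128 + 64 * d ^ 2) * #|T| ^ (d - 2).
Proof.
move=> d2 dT.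
have goodY : good \subset unowned by apply/subsetP => G; rewrite inE => /andP[].
have YF : unowned \subset F by apply/subsetP => G; rewrite inE => /andP[].
have -> : #|F| = #|F :\: unowned| + #|unowned|.
  by rewrite cardsD (setIidPr YF) subnK // subset_leq_card.
apply: (combine_bounds (g := #|good|) (e := #|unowned :\: good|)
  (W := \sum_(B : {set T}) \sum_(v in tips B) defect (v |: B))
  (Q := \sum_(A : {set T} | #|A| == d - 2) #|mutual (fun v => tips (v |: A))|)
  (T0 := \sum_(D : {set T} | #|D| == d) (nb D == set0))
  (T2 := \sum_(D : {set T} | #|D| == d) (#|nb D| == 2))
  (S2 := \sum_(D : {set T} | (#|D| == d) && (1 < #|nb D|)) defect D)
  _ dT (count_unowned _)).
- exact: ltnW.
- by lia.
- by rewrite cardsD (setIidPr goodY) -leq_subLR.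
- exact: subset_leq_card.
- by rewrite (leq_trans card_exceptional) // leq_mul2r leq_bin_expn orbT.
- rewrite (leq_trans card_unowned) // leq_mul2r; apply/orP; right.
  by rewrite -expnS (_ : (d - 2).+1 = d.-1) ?leq_bin_expn //; lia.
- rewrite card_good -(sum_twos (ltnW d2)) !big_distrr /=.
  apply: leq_trans (leq_sum _ (fun B _ => sum_defect_tips B)) _.
  rewrite !big_split /= !leq_add2r [X in _ <= X](bigID (fun B : {set T} => #|B| == d.-1)).
  exact: leq_addr.
- exact: sum_tips_mutual.
- rewrite -sum_zero // !big_distrr /=.
  (* With this threshold, the factor [32 * (d.-1 * d)] of the sets of degree 0 is at most half of
     [L]. *)
  apply: leq_trans (leq_sum _ (fun A _ => card_mutual_tips A (64 * d ^ 2))) _.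
  rewrite big_split /= leq_add2r sum_nat_const leq_mul2r; apply/orP; right.
  apply: leq_trans (leq_bin_expn _ _); rewrite -card_draws; apply: eq_leq.
  by apply: eq_card => A; rewrite !inE.
- rewrite big_distrr [X in X + _]big_mkcond [X in _ + X]big_mkcond [X in _ <= X]big_mkcond.
  rewrite -big_split; apply: leq_sum => D _ /=; case: (_ == d) => //=.
  rewrite -cards_eq0 /defect; by case: #|nb D| => [|[|m]] //=; rewrite ?muln1 ?muln0 ?subn0 ?addn0.
- rewrite big_distrr /= big_mkcond [X in _ <= X]big_mkcond; apply: leq_sum => D _ /=.
case: (_ == d) => //=; rewrite /defect.
by case: eqP => [->|_]; rewrite ?muln1 ?muln0.
Qed.

End UniformFamily.

(* Imported late: Reals rebinds [^] on [nat] to [Nat.pow]. *)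
From Stdlib Require Import Reals Lra.

(** * Passage to real exponents *)

Lemma INR_expn n k : INR (expn n k) = (INR n ^ k)%R.
Proof. by elim: k => // k IHk; rewrite expnS mult_INR IHk. Qed.

Theorem theorem1p3 (d : nat) (hd : 2 <= d) :
  exists (C : R) (n0 : nat), (0 < C)%R /\
    forall n : nat, n0 <= n ->
    forall F : {set {set 'I_n}},
      uniform F d.+1 -> VCdim_le F d ->
      (INR #|F| <= INR 'C(n.-1, d)
         + C * Rpower (INR n) (INR d - 1 - 1 / (4 * INR d - 2)))%R.
Proof.
have [K [K0 bound]] : exists K, 0 < K /\ forall n : nat, 2 * (d + 2) <= n ->
    forall F : {set {set 'I_n}}, uniform F d.+1 -> VCdim_le F d ->
    #|F| <= 'C(n.-1, d) + K * expn n (d - 2).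
  eexists; split; last first.
    move=> n dn F uF vF; have := card_uniform uF vF hd; rewrite card_ord.
    exact.
  by rewrite addn_gt0 addn_gt0 orbT.
exists (INR K), (2 * (d + 2)); split; first by apply: lt_0_INR; apply/ltP.
move=> n dn F uF vF.
have n1 : (1 <= INR n)%R.
  by apply: (le_INR 1); apply/leP; apply: leq_trans dn; rewrite muln_gt0 addn_gt0 orbT.
have d2 : (2 <= INR d)%R by apply: (le_INR 2); apply/leP.
have /leP/le_INR := bound n dn F uF vF.
rewrite plus_INR mult_INR INR_expn -Rpower_pow; last by lra.
move=> le_F; apply: Rle_trans le_F _; apply: Rplus_le_compat_l.
apply: Rmult_le_compat_l; first exact: pos_INR.
(* The exponent [d - 2] reached so far is at most the required one, because [1 / (4 * d - 2) <= 1]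
   for [d >= 2]. *)
apply: Rle_Rpower => //; rewrite minus_INR; last exact/leP.
have : (1 / (4 * INR d - 2) <= 1)%R.
  by apply: (Rmult_le_reg_r (4 * INR d - 2)); [lra | field_simplify; lra].
by rewrite /=; lra.
Qed.
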